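(* Let $((G,\lambda),r)$ be a rooted temporal graph with $n$ vertices, lifetime $\Lambda$ and vertex interval membership sequence $(F_t)_{t\in[\Lambda]}$, and let the sets $L_i$ be defined as below. For every $i$, there is an entry $(D,B,g,c) \in L_i$ if and only if there exists a strategy for \textsc{Temporal Firefighter Reserve} on $((G,\lambda),r)$ such that $D$ and $B$ are exactly the sets of vertices in $F_i$ that are defended and burnt, respectively, by timestep $i$, $g$ is the budget that will be available on timestep $i+1$, and $c$ is the total number of vertices that have burnt by timestep $i$. The sets $L_i$: $L_0 = \{(\emptyset,\{r\},1,1)\}$. For $i \ge 1$, $L_i \subseteq \mathcal{P}(F_i)\times\mathcal{P}(F_i)\times\{1,\dots,\Lambda\}\times\{1,\dots,n\}$ consists exactly of the tuples $(D',B',g-|A|+1,c')$ for which there exist $(D,B,g,c)\in L_{i-1}$ and a set $A \subseteq V(E_i)\setminus(B\cup D)$ such that: (1) $D' = (D\cap F_i)\cup A$; (2) $B' = \big((B\cap F_i)\cup N_i(B)\big)\setminus D'$; (3) $g-|A|+1>0$; (4) $c' = c + |N_i(B)\setminus(B\cup D')|$.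
   Context: A temporal graph is a pair $(G,\lambda)$ with $G=(V,E)$ a finite, connected, undirected, loop-free graph and $\lambda: E \to 2^{\mathbb{N}}$ assigning to each edge the set of timesteps at which it is active; $u,v$ are temporally adjacent at time $t$ if $uv\in E$ and $t \in \lambda(uv)$. The lifetime is $\Lambda=\max\{\max\lambda(e): e\in E\}$. For a vertex $v$, $\mathrm{mintime}(v)$ and $\mathrm{maxtime}(v)$ are the minimum and maximum timesteps at which some edge incident to $v$ is active. The vertex interval membership sequence is $(F_t)_{t\in[\Lambda]}$ with $F_t = \{v\in V : \mathrm{mintime}(v)\le t\le \mathrm{maxtime}(v)\}$. $E_i$ denotes the set of edges active at time $i$; for an edge set $A$, $V(A)$ is the set of vertices incident to an edge of $A$; for $S\subseteq V$, $N_i(S)$ is the set of vertices temporally adjacent at time $i$ to some vertex of $S$. \textsc{Temporal Firefighter Reserve} on $((G,\lambda),r)$: at time $0$ the root $r$ is burning; a budget (initially $0$) is incremented by $1$ at each timestep $t\ge1$, and at that timestep one may defend simultaneously any set of vertices, each neither burning nor already defended, of size at most the current budget, the budget decreasing by the number defended; then the fire spreads from every burning vertex to every vertex that is neither burning nor defended and temporally adjacent to it at time $t$. A strategy specifies the set defended at each timestep. Standing convention: all strategies considered for \textsc{Temporal Firefighter Reserve} defend at timestep $i$ only vertices having an incident edge active at time $i$.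
   Formalization: The claim fails for i ≥ mintime(r) when mintime(r) > 1 (r is dropped from B at step 1), so those i are excluded; the budget range is {1,…,Λ+1} instead of {1,…,Λ}, since never defending gives g = Λ+1 at i = Λ. F_0 = {r} by convention, 0 ≤ i ≤ Λ. *)

(* Defs.v *)
From mathcomp Require Import all_boot finmap.

Set Implicit Arguments.
Unset Strict Implicit.
Unset Printing Implicit Defensive.

Record temporalGraph (V : finType) := TemporalGraph {
  edges : {set {set V}};
  (* The labelling lambda; only its values on [edges] are ever used. Label sets
     are finite, without which the lifetime would not exist. *)
  label : {set V} -> {fset nat};
  edges_card2 : forall e, e \in edges -> #|e| = 2;
  edges_connected :
    forall u v : V, connect (fun x y => [set x; y] \in edges) u v
}.

Section TemporalGraph.

Variables (V : finType) (G : temporalGraph V).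

Definition temporally_adjacent (t : nat) (u v : V) : bool :=
  ([set u; v] \in edges G) && (t \in label G [set u; v]).

Definition lifetime : nat := \max_(e in edges G) \max_(t <- label G e) t.

Definition maxtime (v : V) : nat :=
  \max_(e in edges G | v \in e) \max_(t <- label G e) t.

(* Starting the minimum from [maxtime v] is harmless: it bounds all the times
   in the range. A vertex with no active edge gets mintime = maxtime = 0. *)
Definition mintime (v : V) : nat :=
  \big[minn/maxtime v]_(e in edges G | v \in e)
    \big[minn/maxtime v]_(t <- label G e) t.

Definition active_edges (t : nat) : {set {set V}} :=
  [set e in edges G | t \in label G e].

Definition neighbours (t : nat) (S : {set V}) : {set V} :=
  [set v | [exists u in S, temporally_adjacent t u v]].

(* The vertex interval membership sequence F_t, for 1 <= t <= lifetime. The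
   value F_0 = {r} is a convention: r is the only vertex that occurs in an
   entry of L_0. *)
Definition bag (r : V) (t : nat) : {set V} :=
  if t is 0 then [set r] else [set v | mintime v <= t <= maxtime v].

Section Reserve.

Variables (r : V) (s : nat -> {set V}).

(* [s t] is the set defended at timestep t; [s 0] is never used. *)
Fixpoint defended (t : nat) : {set V} :=
  if t is t'.+1 then defended t' :|: s t else set0.

Fixpoint burnt (t : nat) : {set V} :=
  if t is t'.+1 then
    burnt t' :|: [set v | [&& v \notin burnt t', v \notin defended t &
                            [exists u in burnt t', temporally_adjacent t u v]]]
  else [set r].

(* The budget left at the end of timestep t. *)
Fixpoint budget (t : nat) : nat :=
  if t is t'.+1 then budget t' + 1 - #|s t| else 0.

(* The last clause is the convention that one only defends vertices with an
   incident edge active at that timestep. *)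
Definition reserve_strategy : Prop :=
  forall t, [/\ [disjoint s t.+1 & burnt t :|: defended t],
                #|s t.+1| <= budget t + 1
              & s t.+1 \subset cover (active_edges t.+1)].

End Reserve.

(* [L r i D B g c] means that (D, B, g, c) is an entry of L_i. The new budget
   g - |A| + 1 is written g + 1 - |A|, so that its positivity is the intended
   condition |A| <= g in spite of truncated subtraction. The third components
   range up to lifetime + 1, the value reached at i = lifetime when nothing is
   ever defended. *)
Fixpoint L (r : V) (i : nat) (D' B' : {set V}) (g' c' : nat) : Prop :=
  if i is j.+1 then
    [/\ D' \subset bag r i, B' \subset bag r i,
        1 <= g' <= lifetime + 1, 1 <= c' <= #|V| &
      exists (D B : {set V}) (g c : nat) (A : {set V}),
        [/\ L r j D B g c, A \subset cover (active_edges i) :\: (B :|: D),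
            g' = g + 1 - #|A| &
          [/\ D' = (D :&: bag r i) :|: A,
              B' = ((B :&: bag r i) :|: neighbours i B) :\: D',
              0 < g + 1 - #|A|
            & c' = c + #|neighbours i B :\: (B :|: D')|]]]
  else [/\ D' = set0, B' = [set r], g' = 1 & c' = 1].

End TemporalGraph.

(* Main.v *)
(** A burning or defended vertex affects timestep i only if it has an edge active
    at i. It has also been incident to an active edge before i, so its membership
    interval contains i - 1; the only exception is the root, for which
    [~~ (1 < mintime r <= i)] gives the same conclusion. So restricting the burnt
    and defended sets to the bag loses nothing that the next timestep needs, and
    the recurrence defining L_i is one step of the process intersected with F_i. *)
Require Import Defs.
From mathcomp Require Import all_boot finmap zify.

Set Implicit Arguments.
Unset Strict Implicit.
Unset Printing Implicit Defensive.

Lemma bigminn_leq (I : eqType) (s : seq I) (P : pred I) (F : I -> nat) m x :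
  x \in s -> P x -> \big[minn/m]_(y <- s | P y) F y <= F x.
Proof.
elim: s => // y s IHs; rewrite inE big_cons => /predU1P[<- ->|xs Px].
  exact: geq_minl.
case: ifP => _; last exact: IHs.
by apply: leq_trans (geq_minr _ _) (IHs xs Px).
Qed.

(** * Activity intervals and temporal neighbourhoods *)

Section Intervals.

Variables (V : finType) (G : temporalGraph V).
Implicit Types (v : V) (t : nat).

Lemma cover_active_interval t v :
  v \in cover (active_edges G t) -> mintime G v <= t <= maxtime G v.
Proof.
case/bigcupP=> e; rewrite inE => /andP[eG te] ve; apply/andP; split.
  apply: leq_trans (bigminn_leq _ _ te isT).
  by apply: (@bigminn_leq _ _ _ _ _ e); rewrite ?mem_index_enum ?eG.
apply: leq_trans (@leq_bigmax_seq _ _ predT id _ te isT) _.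
by apply: (@leq_bigmax_cond _ _ (fun e => \max_(t <- label G e) t) e);
   rewrite eG.
Qed.

Lemma cover_active_bag r t v :
  v \in cover (active_edges G t.+1) -> v \in bag G r t.+1.
Proof. by move/cover_active_interval; rewrite inE. Qed.

Lemma adjacent_cover t u v : temporally_adjacent G t u v ->
  u \in cover (active_edges G t) /\ v \in cover (active_edges G t).
Proof.
case/andP=> eG te.
by split; apply/bigcupP; exists [set u; v]; rewrite !inE ?eG ?te ?eqxx ?orbT.
Qed.

Lemma neighboursP t (S : {set V}) v :
  reflect (exists2 u, u \in S & temporally_adjacent G t u v)
          (v \in neighbours G t S).
Proof. by rewrite inE; apply: exists_inP. Qed.

Lemma neighbours_cover t S : neighbours G t S \subset cover (active_edges G t).
Proof.
by apply/subsetP=> v /neighboursP[u _ /adjacent_cover[]].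
Qed.

(** Only members of [S] with an edge active at [t] contribute neighbours, so [S'] need contain no
    others. *)
Lemma neighboursI_cover t (S S' : {set V}) :
    {in cover (active_edges G t), forall v, v \in S -> v \in S'} ->
  neighbours G t (S :&: S') = neighbours G t S.
Proof.
move=> SS'; apply/setP=> v; apply/neighboursP/neighboursP => -[u].
  by case/setIP=> uS _ uv; exists u.
move=> uS uv; exists u => //; rewrite inE uS.
by apply: SS' => //; case: (adjacent_cover uv).
Qed.

End Intervals.

(** * The firefighting process over finitely many timesteps *)

Section Process.

Variables (V : finType) (G : temporalGraph V) (r : V).
Implicit Types (s : nat -> {set V}) (t i j : nat) (v : V).

(** An entry of [L] at [i] constrains only the first [i] moves; this finite horizon lets strategies
    be built one timestep at a time. *)
Definition reserve_strategy_upto i s :=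
  forall t, t < i -> [/\ [disjoint s t.+1 & burnt G r s t :|: defended s t],
                         #|s t.+1| <= budget s t + 1
                       & s t.+1 \subset cover (active_edges G t.+1)].

Lemma reserve_strategy_uptoW i s :
  reserve_strategy_upto i.+1 s -> reserve_strategy_upto i s.
Proof. by move=> sP t /ltnW; apply: sP. Qed.

Lemma eq_process i s s' : (forall t, t < i -> s t.+1 = s' t.+1) ->
  [/\ defended s i = defended s' i, burnt G r s i = burnt G r s' i
    & budget s i = budget s' i].
Proof.
elim: i => // i IHi ss'.
have [|/= -> -> ->] := IHi; first by move=> t /ltnW; apply: ss'.
by rewrite ss'.
Qed.

Lemma eq_reserve_strategy_upto i s s' : (forall t, t < i -> s t.+1 = s' t.+1) ->
  reserve_strategy_upto i s -> reserve_strategy_upto i s'.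
Proof.
move=> ss' sP t ti; rewrite -(ss' _ ti).
have [|<- <- <-] := @eq_process t s s'; last exact: sP.
by move=> t' t't; apply: ss'; apply: ltn_trans ti.
Qed.

(** Defending nothing after timestep [i] is always legal. *)
Lemma extend_reserve_strategy i s : reserve_strategy_upto i s ->
  exists2 s', forall t, t < i -> s t.+1 = s' t.+1 & reserve_strategy G r s'.
Proof.
move=> sP; pose s' t := if t <= i then s t else set0.
have ss' t : t < i -> s t.+1 = s' t.+1 by rewrite /s' => ->.
exists s' => // t; have [ti|ti] := ltnP t i.
  exact: (eq_reserve_strategy_upto ss' sP).
rewrite /s' ltnNge ti /= cards0 sub0set; split=> //.
by rewrite -setI_eq0 set0I.
Qed.

Lemma budget_leq s t : budget s t <= t.
Proof. by elim: t => //= t IHt; lia. Qed.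

Lemma root_burnt s t : r \in burnt G r s t.
Proof. by elim: t => [|t IHt] /=; rewrite !inE ?IHt. Qed.

(** A vertex has an active edge when it is defended, by the convention on strategies. *)
Lemma defended_mintime i s v : reserve_strategy_upto i s ->
  v \in defended s i -> 0 < i /\ mintime G v <= i.
Proof.
elim: i => [|i IHi] sP; rewrite !inE //.
case/orP=> [/(IHi (reserve_strategy_uptoW sP))[]|vs]; first by lia.
have [//|_ _ /subsetP/(_ v vs)/cover_active_interval] := sP i.
by case/andP.
Qed.

(** Every vertex except the root catches fire along an active edge. *)
Lemma burnt_mintime i s v : v \in burnt G r s i ->
  v = r \/ 0 < i /\ mintime G v <= i.
Proof.
elim: i => [|i IHi]; rewrite /= !inE; first by move/eqP; left.
case/orP=> [/IHi[->|[_ vi]]|/and3P[_ _ /exists_inP[u _]]].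
- by left.
- by right; split=> //; apply: ltnW.
by case/adjacent_cover=> _ /cover_active_interval/andP[vi _]; right.
Qed.

Lemma defended_bag_prev j s v : reserve_strategy_upto j s ->
  v \in defended s j -> v \in bag G r j.+1 -> v \in bag G r j.
Proof.
move=> sP /(defended_mintime sP)[]; case: j {sP} => // j _ vj.
by rewrite !inE vj => /andP[_ /ltnW].
Qed.

Lemma burnt_bag_prev j s v : ~~ (1 < mintime G r <= j.+1) ->
  v \in burnt G r s j -> v \in bag G r j.+1 -> v \in bag G r j.
Proof.
move=> hr /burnt_mintime; case: j hr => [|j] hr; rewrite !inE.
  by case=> [->|[]].
(* For the root, membership in the later bag bounds [mintime G r] by [j.+2], so [hr] forces it to be
   at most 1. *)
by case=> [vr|[_ ->]] /andP[vmin /ltnW->] //; rewrite vr in vmin *; lia.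
Qed.

(** Fire never enters a defended vertex, and a legal move never defends a burning one. *)
Lemma burnt_defended_disjoint i s v : reserve_strategy_upto i s ->
  v \in burnt G r s i -> v \notin defended s i.
Proof.
elim: i => [|i IHi] sP /=; rewrite ?inE // => /orP[vB|/and3P[_ vD _]].
  rewrite negb_or (IHi (reserve_strategy_uptoW sP)) //.
  have [//|/disjointFl sBD _ _] := sP i.
  by rewrite sBD // inE vB.
by [].
Qed.

Lemma burntS s t :
  burnt G r s t.+1 = burnt G r s t :|:
    (neighbours G t.+1 (burnt G r s t) :\: (burnt G r s t :|: defended s t.+1)).
Proof.
apply/setP=> v; rewrite !inE !negb_or.
by case: (v \in burnt _ _ _ _).
Qed.

Lemma card_burntS s t :
  #|burnt G r s t.+1| = #|burnt G r s t| +
    #|neighbours G t.+1 (burnt G r s t) :\: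
      (burnt G r s t :|: defended s t.+1)|.
Proof.
rewrite burntS cardsU -[RHS]subn0; congr (_ - _).
apply/eqP; rewrite cards_eq0 -subset0; apply/subsetP=> v.
by rewrite !inE => /and3P[->].
Qed.

(** * One timestep seen through the bags *)

Section Step.

Variables (j : nat) (s : nat -> {set V}).
Hypothesis sP : reserve_strategy_upto j s.
Hypothesis hr : ~~ (1 < mintime G r <= j.+1).

Lemma neighbours_burnt_bag :
  neighbours G j.+1 (burnt G r s j :&: bag G r j) =
  neighbours G j.+1 (burnt G r s j).
Proof.
apply: neighboursI_cover => v /(cover_active_bag r) vj vB.
exact: burnt_bag_prev hr vB vj.
Qed.

Lemma in_burnt_bag v : v \in bag G r j.+1 ->
  (v \in burnt G r s j :&: bag G r j) = (v \in burnt G r s j).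
Proof.
by move=> vj; rewrite inE andb_idr // => vB; apply: burnt_bag_prev hr vB vj.
Qed.

Lemma in_defended_bag v : v \in bag G r j.+1 ->
  (v \in defended s j :&: bag G r j) = (v \in defended s j).
Proof.
by move=> vj; rewrite inE andb_idr // => vD; apply: defended_bag_prev sP vD vj.
Qed.

(** Vertices active at [j.+1] lie in its bag, where the truncated and full sets agree. Legality of
    [s] is assumed only up to [j], so the lemma can certify [A] as the next move. *)
Lemma sub_cover_setD_bag (A : {set V}) :
  (A \subset cover (active_edges G j.+1) :\:
     ((burnt G r s j :&: bag G r j) :|: (defended s j :&: bag G r j))) =
  [disjoint A & burnt G r s j :|: defended s j] &&
  (A \subset cover (active_edges G j.+1)).
Proof.
rewrite subsetD andbC; have [/subsetP AC|] := boolP (A \subset _); last first.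
  by rewrite !andbF.
rewrite !andbT -!setI_eq0; congr (_ == _); apply/setP=> v.
rewrite !(in_setI v A); have [/AC/(cover_active_bag r) vj|//] :=
  boolP (v \in A).
by rewrite in_setU in_burnt_bag // in_defended_bag // !inE.
Qed.

End Step.

Section StepBag.

Variables (j : nat) (s : nat -> {set V}).
Hypothesis sP : reserve_strategy_upto j.+1 s.
Hypothesis hr : ~~ (1 < mintime G r <= j.+1).

Let sPj := reserve_strategy_uptoW sP.

Lemma defended_bagS :
  defended s j.+1 :&: bag G r j.+1 =
  (defended s j :&: bag G r j :&: bag G r j.+1) :|: s j.+1.
Proof.
have [//|_ _ /subsetP sC] := sP (t := j).
apply/setP=> v; rewrite in_setI in_setU in_setI /= in_setU.
have [vj|vj] := boolP (v \in bag G r j.+1).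
  by rewrite in_defended_bag // !andbT.
(* Outside the bag nothing is newly defended, since [s j.+1] consists of active vertices. *)
by rewrite !andbF; apply/esym; apply: contraNF vj => /sC/cover_active_bag.
Qed.

Lemma burnt_bagS :
  burnt G r s j.+1 :&: bag G r j.+1 =
  ((burnt G r s j :&: bag G r j :&: bag G r j.+1) :|:
     neighbours G j.+1 (burnt G r s j :&: bag G r j)) :\:
  (defended s j.+1 :&: bag G r j.+1).
Proof.
rewrite neighbours_burnt_bag //; apply/setP=> v.
rewrite in_setI in_setD in_setU (in_setI v (defended _ _)).
rewrite (in_setI v (_ :&: _)).
have [vj|vj] := boolP (v \in bag G r j.+1); last first.
  rewrite !andbF /=; apply/esym; apply: contraNF vj.
  by move/(subsetP (neighbours_cover _ _ _))/cover_active_bag.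
rewrite in_burnt_bag // !andbT.
(* The recurrence removes defended vertices from the old burnt set too; disjointness makes this
   harmless. *)
have := @burnt_defended_disjoint j.+1 s v sP.
rewrite burntS in_setU in_setD in_setU negb_or.
by have [vB /(_ isT) ->|_ _] := boolP (v \in burnt G r s j).
Qed.

Lemma card_burnt_bagS :
  #|burnt G r s j.+1| = #|burnt G r s j| +
    #|neighbours G j.+1 (burnt G r s j :&: bag G r j) :\:
      ((burnt G r s j :&: bag G r j) :|: (defended s j.+1 :&: bag G r j.+1))|.
Proof.
rewrite card_burntS neighbours_burnt_bag //; congr (_ + _).
apply: eq_card => v; rewrite !in_setD; apply: andb_id2r.
move/(subsetP (neighbours_cover _ _ _))/(cover_active_bag r) => vj.
by rewrite !(in_setU, in_burnt_bag) // (in_setI v (defended _ _)) vj andbT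
           in_setU.
Qed.

End StepBag.

(** * From entries of [L] to strategies and back *)

Lemma L_strategy_upto i D B g c : ~~ (1 < mintime G r <= i) ->
  L G r i D B g c ->
  exists s, reserve_strategy_upto i s /\
    [/\ D = defended s i :&: bag G r i, B = burnt G r s i :&: bag G r i,
        g = budget s i + 1 & c = #|burnt G r s i|].
Proof.
elim: i D B g c => [|j IHj] D' B' g' c' hr.
  move=> [-> -> -> ->]; exists (fun=> set0); split=> //=.
  by rewrite set0I setIid cards1.
case=> _ _ _ _ [D [B [g [c [A [/IHj IH AC -> [-> -> gA ->]]]]]]].
have [|s [sP [Ds Bs gs cs]]] := IH; first by lia.
(* The strategy for the preceding entry is overridden at [j.+1] by the set [A] of the transition;
   its earlier history is unchanged. *)
pose s' t := if t == j.+1 then A else s t.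
have ss' t : t < j -> s t.+1 = s' t.+1.
  by move=> tj; rewrite /s' eqSS ltn_eqF.
have [eqD eqB eqb] := eq_process ss'.
have sP'j := eq_reserve_strategy_upto ss' sP.
have s'A : s' j.+1 = A by rewrite /s' eqxx.
rewrite eqD in Ds; rewrite eqB in Bs cs; rewrite eqb in gs.
move: AC; rewrite Ds Bs sub_cover_setD_bag // => /andP[disA AC].
have sP' : reserve_strategy_upto j.+1 s'.
  move=> t; rewrite ltnS leq_eqVlt => /predU1P[->|]; last exact: sP'j.
  by rewrite s'A; split=> //; lia.
exists s'; split=> //; rewrite -s'A -defended_bagS // -burnt_bagS //.
rewrite cs -card_burnt_bagS // s'A; split=> //=.
by rewrite s'A; lia.
Qed.

Lemma strategy_upto_L i s : i <= lifetime G -> ~~ (1 < mintime G r <= i) ->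
    reserve_strategy_upto i s ->
  L G r i (defended s i :&: bag G r i) (burnt G r s i :&: bag G r i)
    (budget s i + 1) #|burnt G r s i|.
Proof.
elim: i => [|j IHj] hi hr sP; first by rewrite /= set0I setIid cards1.
have sPj := reserve_strategy_uptoW sP.
have [//|disA cardA AC] := sP j.
split; rewrite ?subsetIr ?max_card //.
(* The budget grows by at most one per timestep, which gives the upper bound on [g]. *)
- by rewrite !addn1; apply: leq_trans hi; apply: budget_leq.
(* The root always burns, so the count is positive. *)
- by rewrite andbT; apply/card_gt0P; exists r; apply: root_burnt.
exists (defended s j :&: bag G r j), (burnt G r s j :&: bag G r j).
exists (budget s j + 1), #|burnt G r s j|, (s j.+1); split.
- by apply: IHj => //; [exact: ltnW | lia].
- by rewrite sub_cover_setD_bag // disA.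
- by rewrite /=; lia.
- by split; [exact: defended_bagS | exact: burnt_bagS | lia
            | exact: card_burnt_bagS].
Qed.

End Process.

Theorem theorem16 (V : finType) (G : temporalGraph V) (r : V) (i : nat)
    (hi : i <= lifetime G) (hr : ~~ (1 < mintime G r <= i))
    (D B : {set V}) (g c : nat) :
  L G r i D B g c <->
  exists s : nat -> {set V},
    reserve_strategy G r s /\
    [/\ D = defended s i :&: bag G r i,
        B = burnt G r s i :&: bag G r i,
        g = budget s i + 1
      & c = #|burnt G r s i|].
Proof.
split=> [/(L_strategy_upto hr)[s [sP eqs]]|[s [sP [-> -> -> ->]]]].
  have [s' ss' s'P] := extend_reserve_strategy sP.
  by exists s'; split=> //; have [<- <- <-] := eq_process G r ss'.
by apply: strategy_upto_L => // t _; apply: sP.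
Qed.
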